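(* Let $\{X_f:f\in\mathcal F\}$ be a set of random variables on a common probability space. Then the relation $\trianglelefteq_{\mathrm{strong}}$ defines a partial order on this set (random variables that are almost surely equal being identified): it is reflexive, transitive and antisymmetric.
   Context: For $\eta>0$, $X\trianglelefteq_\eta Y$ means $\mathbf E[e^{\eta(X-Y)}]\le1$. $X\trianglelefteq_{\mathrm{strong}}Y$ holds if and only if there exists $\eta^*>0$ such that $X\trianglelefteq_{\eta^*}Y$. Antisymmetry means: $X\trianglelefteq_{\mathrm{strong}}Y$ and $Y\trianglelefteq_{\mathrm{strong}}X$ imply $X=Y$ almost surely. *)

(* Defs.v *)
From HB Require Import structures.
From mathcomp Require Import all_boot all_order all_algebra.
From mathcomp Require Import all_classical all_reals all_analysis.

Set Implicit Arguments.
Unset Strict Implicit.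
Unset Printing Implicit Defensive.

Import Order.TTheory GRing.Theory Num.Theory.
Local Open Scope classical_set_scope.
Local Open Scope ring_scope.

(* The expectation is taken in the extended reals; its integrand is
   nonnegative, so it is always well defined, with value +oo when the
   exponential moment is infinite. *)
Definition esi (d : measure_display) (T : measurableType d) (R : realType)
    (P : probability T R) (eta : R) (X Y : {RV P >-> R}) : Prop :=
  ('E_P[fun w => expR (eta * (X w - Y w))] <= 1)%E.

Definition strong_esi (d : measure_display) (T : measurableType d)
    (R : realType) (P : probability T R) (X Y : {RV P >-> R}) : Prop :=
  exists eta : R, 0 < eta /\ esi eta X Y.

(* Main.v *)
(* Transitivity: if X is r-below Y and Y is s-below Z, take weights a + b = 1
   with a r = b s = eta; convexity of exp then gives
   exp (eta (X - Z)) <= a exp (r (X - Y)) + b exp (s (Y - Z)).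
   Antisymmetry: if X is r-below Y and Y is s-below X, then
   s exp (r (X - Y)) + r exp (s (Y - X)) is pointwise at least s + r, with
   equality only where X = Y, while its expectation is at most s + r. *)
Require Import Defs.
From HB Require Import structures.
From mathcomp Require Import all_boot all_order all_algebra.
From mathcomp Require Import all_classical all_reals all_analysis.
From mathcomp Require Import measurable_realfun ring lra.

Set Implicit Arguments.
Unset Strict Implicit.
Unset Printing Implicit Defensive.

Import Order.TTheory GRing.Theory Num.Theory.
Local Open Scope classical_set_scope.
Local Open Scope ring_scope.

(** The tangent bound [1 + x <= expR x] is applied at [u] and [v]; the linear terms cancel in the
    weighted sum. *)
Lemma expR_weighted_ge (R : realType) (a b u v : R) :
  0 <= a -> 0 <= b -> a * u + b * v = 0 -> a + b <= a * expR u + b * expR v.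
Proof.
move=> a0 b0 uv0.
have := ler_wpM2l a0 (expR_ge1Dx u); have := ler_wpM2l b0 (expR_ge1Dx v).
lra.
Qed.

(** The tangent bound is strict away from 0, so [u != 0] would make the weighted sum exceed
    [a + b]. *)
Lemma expR_weighted_eq (R : realType) (a b u v : R) :
  0 < a -> 0 < b -> a * u + b * v = 0 ->
  a * expR u + b * expR v = a + b -> u = 0.
Proof.
move=> a0 b0 uv0 e; apply/eqP/negPn/negP => u0.
have := expR_gt1Dx u0; rewrite -(ltr_pM2l a0) => lt_u.
have := ler_wpM2l (ltW b0) (expR_ge1Dx v); lra.
Qed.

(** The deviations [u - m] and [v - m] from the weighted mean [m] have weighted sum 0, so
    [expR_weighted_ge] applies to them; multiplying by [expR m] gives the claim. *)
Lemma expR_convex_comb (R : realType) (a b u v : R) :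
  0 <= a -> 0 <= b -> a + b = 1 ->
  expR (a * u + b * v) <= a * expR u + b * expR v.
Proof.
move=> a0 b0 ab1; set m := a * u + b * v.
have := @expR_weighted_ge _ a b (u - m) (v - m) a0 b0.
rewrite !mulrBr addrACA -opprD -mulrDl ab1 mul1r subrr => /(_ erefl).
rewrite -(ler_pM2r (expR_gt0 m)) mul1r mulrDl -!mulrA -!expRD.
by rewrite !subrK.
Qed.

Lemma esiE (d : measure_display) (T : measurableType d) (R : realType)
    (P : probability T R) (eta : R) (X Y : {RV P >-> R}) :
  esi eta X Y = (\int[P]_w (expR (eta * (X w - Y w)))%:E <= 1)%E :> Prop.
Proof. by rewrite /esi unlock. Qed.

Lemma measurable_expR_scaled_diff (d : measure_display) (T : measurableType d)
    (R : realType) (eta : R) (X Y : {mfun T >-> R}) :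
  measurable_fun setT (fun w => expR (eta * (X w - Y w))).
Proof.
apply: measurableT_comp => //.
by apply: measurable_funM => //; exact: measurable_funB.
Qed.

Lemma integral_cst_probability (d : measure_display) (T : measurableType d)
    (R : realType) (P : probability T R) (c : R) :
  (\int[P]_w c%:E = c%:E)%E.
Proof.
rewrite integral_cst // -[RHS]mule1; congr (_ * _)%E.
exact: probability_setT.
Qed.

(** Nonnegativity of weights and integrands justifies splitting the integral in the extended
    reals. *)
Lemma integral_weighted_le (d : measure_display) (T : measurableType d)
    (R : realType) (P : probability T R) (a b : R) (f g : T -> R) :
  0 <= a -> 0 <= b -> measurable_fun setT f -> measurable_fun setT g ->
  (forall w, 0 <= f w) -> (forall w, 0 <= g w) ->
  (\int[P]_w (f w)%:E <= 1)%E -> (\int[P]_w (g w)%:E <= 1)%E ->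
  (\int[P]_w (a * f w + b * g w)%:E <= (a + b)%:E)%E.
Proof.
move=> a0 b0 mf mg f0 g0 f1 g1.
under eq_integral do rewrite EFinD !EFinM.
have mf' : measurable_fun setT (EFin \o f) by exact/measurable_EFinP.
have mg' : measurable_fun setT (EFin \o g) by exact/measurable_EFinP.
rewrite ge0_integralD //.
- rewrite ge0_integralZl_EFin //; last by move=> w _; rewrite lee_fin.
  rewrite ge0_integralZl_EFin //; last by move=> w _; rewrite lee_fin.
  rewrite EFinD leeD //.
    by rewrite -[leRHS]mule1; apply: lee_wpmul2l.
  by rewrite -[leRHS]mule1; apply: lee_wpmul2l.
- by move=> w _; rewrite mule_ge0 ?lee_fin.
- exact: measurable_funeM.
- by move=> w _; rewrite mule_ge0 ?lee_fin.
- exact: measurable_funeM.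
Qed.

(** The excess [f - c] is nonnegative and its integral is 0, so it vanishes almost everywhere. *)
Lemma ae_eq_cst_of_integral_le (d : measure_display) (T : measurableType d)
    (R : realType) (P : probability T R) (c : R) (f : T -> R) :
  0 <= c -> measurable_fun setT f -> (forall w, c <= f w) ->
  (\int[P]_w (f w)%:E <= c%:E)%E -> f = cst c %[ae P].
Proof.
move=> c0 mf cf fc.
have mh : measurable_fun setT (fun w => (f w - c)%:E).
  by apply/measurable_EFinP; exact: measurable_funB.
have h0 w : (0 <= (f w - c)%:E)%E by rewrite lee_fin subr_ge0.
have split_f : (\int[P]_w (f w)%:E = c%:E + \int[P]_w (f w - c)%:E)%E.
  under eq_integral do rewrite -(subrKC c (f _)) EFinD.
  rewrite ge0_integralD //.
  by rewrite integral_cst_probability.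
have int0 : (\int[P]_w `|(f w - c)%:E| = 0)%E.
  under eq_integral do rewrite gee0_abs //.
  apply/eqP; rewrite eq_le integral_ge0 // andbT.
  (* Cancelling [c] on both sides is legitimate because it is finite. *)
  by move: fc; rewrite split_f -[leRHS]adde0 leeD2lE.
have /ae_eq_integral_abs := int0 => /(_ measurableT mh).
by apply: filterS => w /(_ I) [] /eqP; rewrite subr_eq0 => /eqP.
Qed.

Lemma strong_esi_refl (d : measure_display) (T : measurableType d)
    (R : realType) (P : probability T R) (X : {RV P >-> R}) : strong_esi X X.
Proof.
exists 1; split => //; rewrite esiE.
under eq_integral do rewrite subrr mulr0 expR0.
by rewrite integral_cst_probability.
Qed.

(** This lets the relation descend to almost sure classes. The same [eta] serves, since the two
    integrands agree almost everywhere. *)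
Lemma strong_esi_ae (d : measure_display) (T : measurableType d)
    (R : realType) (P : probability T R) (X X' Y Y' : {RV P >-> R}) :
  X = X' %[ae P] -> Y = Y' %[ae P] -> strong_esi X Y -> strong_esi X' Y'.
Proof.
move=> eX eY [eta [eta0]]; rewrite esiE => XY.
exists eta; split => //; rewrite esiE; apply: le_trans XY.
rewrite le_eqVlt; apply/orP; left; apply/eqP.
apply: ge0_ae_eq_integral => //.
- by apply/measurable_EFinP; exact: measurable_expR_scaled_diff.
- by apply/measurable_EFinP; exact: measurable_expR_scaled_diff.
- by move: eX eY; apply: filterS2 => w Xw Yw _; rewrite Xw // Yw.
Qed.

Lemma strong_esi_trans (d : measure_display) (T : measurableType d)
    (R : realType) (P : probability T R) (X Y Z : {RV P >-> R}) :
  strong_esi X Y -> strong_esi Y Z -> strong_esi X Z.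
Proof.
move=> [r [r0]]; rewrite esiE => XY [s [s0]]; rewrite esiE => YZ.
have rs0 : 0 < r + s by rewrite addr_gt0.
have rs_neq0 : r + s != 0 by rewrite gt_eqF.
have ab1 : s / (r + s) + r / (r + s) = 1 by field.
have a0 : 0 <= s / (r + s) by rewrite divr_ge0 ?ltW.
have b0 : 0 <= r / (r + s) by rewrite divr_ge0 ?ltW.
(* Solving [a * r = b * s] with [a + b = 1] gives [a = s / (r + s)] and [b = r / (r + s)]; the
   witness is the common value. *)
exists (r * s / (r + s)); split; first by rewrite divr_gt0 ?mulr_gt0.
have mXY := measurable_expR_scaled_diff r X Y.
have mYZ := measurable_expR_scaled_diff s Y Z.
rewrite esiE.
have := integral_weighted_le a0 b0 mXY mYZ
  (fun=> expR_ge0 _) (fun=> expR_ge0 _) XY YZ.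
rewrite ab1; apply: le_trans; apply: ge0_le_integral => //.
- by apply/measurable_EFinP; exact: measurable_expR_scaled_diff.
- apply/measurable_EFinP; apply: measurable_funD; exact: measurable_funM.
move=> w _; rewrite lee_fin.
have -> : r * s / (r + s) * (X w - Z w) =
    s / (r + s) * (r * (X w - Y w)) + r / (r + s) * (s * (Y w - Z w)).
  by field.
exact: expR_convex_comb.
Qed.

Lemma strong_esi_antisym (d : measure_display) (T : measurableType d)
    (R : realType) (P : probability T R) (X Y : {RV P >-> R}) :
  strong_esi X Y -> strong_esi Y X -> X = Y %[ae P].
Proof.
move=> [r [r0]]; rewrite esiE => XY [s [s0]]; rewrite esiE => YX.
have mXY := measurable_expR_scaled_diff r X Y.
have mYX := measurable_expR_scaled_diff s Y X.
(* Each exponent is weighted by the rate of the other, so that the linear terms cancel. *)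
have cancel w : s * (r * (X w - Y w)) + r * (s * (Y w - X w)) = 0 by ring.
have le_sr := integral_weighted_le (ltW s0) (ltW r0) mXY mYX
  (fun=> expR_ge0 _) (fun=> expR_ge0 _) XY YX.
have sr0 : 0 <= s + r by rewrite addr_ge0 ?ltW.
have ge_sr w : s + r <=
    s * expR (r * (X w - Y w)) + r * expR (s * (Y w - X w)).
  by apply: expR_weighted_ge; rewrite ?ltW.
have msr : measurable_fun setT (fun w =>
    s * expR (r * (X w - Y w)) + r * expR (s * (Y w - X w))).
  by apply: measurable_funD; exact: measurable_funM.
have := ae_eq_cst_of_integral_le sr0 msr ge_sr le_sr.
(* Where the lower bound is attained, [r * (X w - Y w)] is 0, and [r] is positive. *)
apply: filterS => w /(_ I) /(expR_weighted_eq s0 r0 (cancel w)) /eqP.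
by rewrite mulf_eq0 gt_eqF //= subr_eq0 => /eqP.
Qed.

Theorem proposition11 (d : measure_display) (T : measurableType d)
    (R : realType) (P : probability T R) (F : Type) (X : F -> {RV P >-> R}) :
  [/\ (* compatible with almost sure equality *)
      forall f f' g g' : F,
        X f = X f' %[ae P] -> X g = X g' %[ae P] ->
        (strong_esi (X f) (X g) <-> strong_esi (X f') (X g')),
      (* reflexive *)
      forall f : F, strong_esi (X f) (X f),
      (* transitive *)
      forall f g h : F,
        strong_esi (X f) (X g) -> strong_esi (X g) (X h) ->
        strong_esi (X f) (X h)
    & (* antisymmetric *)
      forall f g : F,
        strong_esi (X f) (X g) -> strong_esi (X g) (X f) ->
        X f = X g %[ae P] ].
Proof.
split.
- move=> f f' g g' ef eg; split; first exact: strong_esi_ae.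
  (* The converse uses the same lemma with both almost sure equalities reversed. *)
  by apply: strong_esi_ae; [move: ef|move: eg];
    apply: filterS => w e _; rewrite e.
- by move=> f; exact: strong_esi_refl.
- by move=> f g h; exact: strong_esi_trans.
- by move=> f g; exact: strong_esi_antisym.
Qed.
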